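(* Let $p\in\mathbb{C}[z]$ be a polynomial of degree $n\ge2$ with roots $\lambda_1,\ldots,\lambda_n$, and let $\mu_1,\ldots,\mu_{n-1}$ be the roots of its derivative $p'$ (roots listed with multiplicity). Then for any convex function $f:\mathbb{C}\to\mathbb{R}$, any $\alpha\in\mathbb{C}$ and any $k\in\{1,\ldots,n-1\}$, $$\frac1{\binom{n-1}{k}}\sum_{1\le i_1<\ldots<i_k\le n-1}f\left(\prod_{j=1}^k(\mu_{i_j}-\alpha)\right)\le\frac1{\binom{n}{k}}\sum_{1\le i_1<\ldots<i_k\le n}f\left(\prod_{j=1}^k(\lambda_{i_j}-\alpha)\right).$$
   Context: Convexity of $f:\mathbb{C}\to\mathbb{R}$ is with respect to the identification $\mathbb{C}\cong\mathbb{R}^2$. *)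

(* Defs.v *)
From HB Require Import structures.
From mathcomp Require Import all_boot all_order all_algebra.
From mathcomp Require Import complex.
From mathcomp Require Import classical_sets reals convex.

Set Implicit Arguments.
Unset Strict Implicit.
Unset Printing Implicit Defensive.

Import Order.TTheory GRing.Theory Num.Theory.

Local Open Scope ring_scope.

(* [R[i]] is a module over itself; the real vector space underlying it is      *)
(* its alias [Rcomplex R], on which [a *: (x +i* y)] is [(a * x) +i* (a * y)]  *)
(* for [a : R].                                                                *)
Definition convex_on_complex (R : realType) (f : R[i] -> R) : Prop :=
  @convex_function R (Rcomplex R) [set: Rcomplex R]%classic f.

(* [r] lists the roots of [q] with multiplicity. This holds for [q = 0] and     *)
(* any [r]; for [q != 0] it forces [size q = m.+1].                            *)
Definition lists_roots (F : fieldType) (q : {poly F}) (m : nat)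
    (r : 'I_m -> F) : Prop :=
  q = lead_coef q *: \prod_(i < m) ('X - (r i)%:P).

(* A choice of indices [i_1 < ... < i_k] is the [k]-element set of its values. *)
Definition mean_subprod (R : realType) (f : R[i] -> R) (a : R[i]) (m k : nat)
    (r : 'I_m -> R[i]) : R :=
  ('C(m, k)%:R)^-1 *
    \sum_(I : {set 'I_m} | #|I| == k) f (\prod_(j in I) (r j - a)).

(* Main.v *)
(* Let V have as rows an orthonormal basis of the orthogonal complement of     *)
(* (1,...,1), so that V V^* = 1 and V^* V = 1 - J/n with J the all-ones        *)
(* matrix. The characteristic polynomial of V diag(lambda) V^* is p' up to a   *)
(* scalar, and by Schur's theorem V can be chosen so that this matrix is       *)
(* triangular, hence with diagonal mu. The diagonal of the k-th compound of    *)
(* V diag(lambda - alpha) V^* then consists of the products of the             *)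
(* mu_i - alpha; by Cauchy-Binet each of them is the average of the products   *)
(* of the lambda_j - alpha, with weights the squared moduli of the k-minors of *)
(* V. The weights of one product of the lambda's add up to a principal         *)
(* k-minor of 1 - J/n, which is 1 - k/n, and Jensen's inequality concludes     *)
(* because C(n-1,k) = (1 - k/n) C(n,k).                                        *)
Require Import Defs.
From HB Require Import structures.
From mathcomp Require Import all_boot all_order all_algebra all_fingroup.
From mathcomp Require Import complex.
From mathcomp Require Import classical_sets reals convex.
From mathcomp Require Import interval_inference.

Import Order.TTheory GRing.Theory Num.Theory.

Local Open Scope ring_scope.
Local Open Scope sesquilinear_scope.
Local Open Scope complex_scope.

(** Compressing the diagonal matrix of the roots to the hyperplane orthogonal to (1,...,1) gives a
    matrix whose eigenvalues are the critical points ([char_poly_compression]); it can be made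
    triangular ([triangular_compression]). Its principal k-minors exhibit products of the mu_i -
    alpha as means of products of the lambda_j - alpha, and [sum_convex_compression_le] combines
    Jensen's inequality with the row and column sums of the weights. Sums over k-subsets are handled
    as sums over injective functions on ['I_k], which count each subset k! times
    ([sum_inj_ffun_subsets]). *)

(** * Cauchy-Binet over index functions *)

Lemma det_mulmx_sum_ffun (R : comNzRingType) (k n : nat)
    (A : 'M[R]_(k, n)) (B : 'M[R]_(n, k)) :
  \det (A *m B) =
  \sum_(g : {ffun 'I_k -> 'I_n}) \prod_i A i (g i) * \det (rowsub g B).
Proof.
rewrite /(\det (A *m B)).
under eq_bigr => s _.
  under eq_bigr => i _ do rewrite mxE.
  rewrite bigA_distr_bigA big_distrr /=.
  over.
rewrite exchange_big; apply: eq_bigr => g _ /=.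
rewrite big_distrr; apply: eq_bigr => s _ /=.
rewrite big_split /= mulrCA; congr (_ * (_ * _)).
by apply: eq_bigr => i _; rewrite mxE.
Qed.

(* Cauchy-Binet, summed over all index functions rather than over k-subsets:  *)
(* functions that are not injective contribute 0, and each subset arises from *)
(* k! injective functions.                                                    *)
Lemma Cauchy_Binet_ffun (R : comNzRingType) (k n : nat)
    (A : 'M[R]_(k, n)) (B : 'M[R]_(n, k)) :
  \det (A *m B) *+ k`! =
  \sum_(g : {ffun 'I_k -> 'I_n}) \det (colsub g A) * \det (rowsub g B).
Proof.
(* Precomposing g with s permutes the rows of the minor of [B] and costs the sign of s; summing over
   s turns the product of entries of [A] into a determinant. *)
have permute (s : 'S_k) : \det (A *m B) =
    \sum_(g : {ffun 'I_k -> 'I_n})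
      (-1) ^+ s * \prod_i A i (g (s i)) * \det (rowsub g B).
  rewrite det_mulmx_sum_ffun.
  rewrite (reindex_inj (h := fun g : {ffun 'I_k -> 'I_n} => [ffun i => g (s i)])) /=.
    apply: eq_bigr => g _.
    have -> : rowsub [ffun i => g (s i)] B = row_perm s (rowsub g B).
      by apply/matrixP => i j; rewrite !mxE ffunE.
    rewrite row_permE det_mulmx det_perm mulrA; congr (_ * _).
    by rewrite mulrC; congr (_ * _); apply: eq_bigr => i _; rewrite ffunE.
  move=> g1 g2 /ffunP eq12; apply/ffunP => i.
  by have := eq12 (s^-1 i)%g; rewrite !ffunE permKV.
rewrite -card_Sn -sumr_const.
under eq_bigr => s _ do rewrite (permute s).
rewrite exchange_big; apply: eq_bigr => g _ /=.
rewrite -big_distrl /=; congr (_ * _).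
by apply: eq_bigr => s _; congr (_ * _); apply: eq_bigr => i _; rewrite mxE.
Qed.

Lemma sum_det_mxsub (R : comNzRingType) (k m n p : nat)
    (a : 'I_k -> 'I_m) (b : 'I_k -> 'I_p) (A : 'M[R]_(m, n)) (B : 'M[R]_(n, p)) :
  \sum_(g : {ffun 'I_k -> 'I_n}) \det (mxsub a g A) * \det (mxsub g b B) =
  \det (mxsub a b (A *m B)) *+ k`!.
Proof.
rewrite mxsub_mul Cauchy_Binet_ffun; apply: eq_bigr => g _.
by congr (_ * _); congr (\det _); apply/matrixP => i j; rewrite !mxE.
Qed.

Lemma det_mxsub_mul_diag (R : comNzRingType) (k m n : nat)
    (h : 'I_k -> 'I_m) (V : 'M[R]_(m, n)) (d : 'rV[R]_n) (U : 'M[R]_(n, m)) :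
  \det (mxsub h h (V *m diag_mx d *m U)) *+ k`! =
  \sum_(g : {ffun 'I_k -> 'I_n})
    (\det (mxsub h g V) * \det (mxsub g h U)) * \prod_j d 0 (g j).
Proof.
rewrite -sum_det_mxsub; apply: eq_bigr => g _.
have -> : mxsub h g (V *m diag_mx d) =
    mxsub h g V *m diag_mx (\row_j d 0 (g j)).
  by apply/matrixP => i j; rewrite !mul_mx_diag !mxE.
rewrite det_mulmx det_diag mulrAC; congr (_ * _ * _).
by apply: eq_bigr => j _; rewrite mxE.
Qed.

(** * Minors of triangular matrices and of 1 - J/n *)

(** As [h] need not be increasing, the submatrix need not be triangular. But permuting by s
    preserves the sum of the [h j], so if s is not 1 some [h (s j)] exceeds [h j], and the term of s
    contains a zero entry. *)
Lemma det_mxsub_trig (R : comNzRingType) (k m : nat) (h : 'I_k -> 'I_m)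
    (T : 'M[R]_m) :
  injective h -> is_trig_mx T ->
  \det (mxsub h h T) = \prod_j T (h j) (h j).
Proof.
move=> h_inj /is_trig_mxP trigT.
rewrite /(\det _) (bigD1 1%g) //= [X in _ + X]big1 ?addr0 => [|s s_neq1].
  by rewrite odd_perm1 mul1r; apply: eq_bigr => j _; rewrite mxE perm1.
have [j lt_j] : exists j, (h j < h (s j))%N.
  apply/existsP; apply: contraNT s_neq1; rewrite negb_exists => /forallP le_h.
  have leif_h j : true -> (h (s j) <= h j ?= iff (s j == j))%N.
    by move=> _; split; [rewrite leqNgt le_h | rewrite val_eqE (inj_eq h_inj)].
  have := leqif_sum leif_h => -[_].
  have -> : (\sum_j h (s j) = \sum_j h j)%N by rewrite [RHS](reindex_perm s).
  rewrite eqxx => /esym/forallP fix_s.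
  by apply/eqP/permP => j; rewrite perm1; apply/eqP/fix_s.
by rewrite (bigD1 j) //= mxE trigT // mul0r mulr0.
Qed.

(** The bordered matrix [A] factors both as lower times upper and as upper times lower block
    triangular; compare determinants. *)
Lemma det_1_sub_mul (R : comNzRingType) (k : nat) (u : 'cV[R]_k) (v : 'rV[R]_k) :
  \det (1%:M - u *m v) = 1 - (v *m u) 0 0.
Proof.
pose A : 'M[R]_(1 + k) := block_mx 1%:M v u 1%:M.
have <- : \det A = \det (1%:M - u *m v).
  have -> : A = block_mx 1%:M 0 u 1%:M *m block_mx 1%:M v 0 (1%:M - u *m v).
    rewrite mulmx_block !mul1mx !mulmx1 !mul0mx !addr0.
    by rewrite addrC subrK.
  by rewrite det_mulmx det_lblock det_ublock !det1 !mul1r.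
have -> : A = block_mx (1%:M - v *m u) v 0 1%:M *m block_mx 1%:M 0 u 1%:M.
  by rewrite mulmx_block !mul1mx !mulmx1 ?mul0mx ?mulmx0 !add0r subrK.
by rewrite det_mulmx det_lblock det_ublock !det1 !mulr1 det_mx11 !mxE eqxx.
Qed.

Lemma det_mxsub_1_sub_const (R : comNzRingType) (k n : nat) (g : 'I_k -> 'I_n)
    (c : R) :
  injective g -> \det (mxsub g g (1%:M - const_mx c)) = 1 - c *+ k.
Proof.
move=> g_inj.
have -> : mxsub g g (1%:M - const_mx c) =
    1%:M - (const_mx c : 'cV_k) *m (const_mx 1 : 'rV_k).
  apply/matrixP => i j.
  by rewrite !mxE big_ord1 !mxE mulr1 (inj_eq g_inj).
rewrite det_1_sub_mul mxE; congr (1 - _).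
under eq_bigr => i _ do rewrite !mxE mul1r.
by rewrite sumr_const card_ord.
Qed.

Lemma det_mxsub_not_inj (R : comNzRingType) (k m n : nat) (h : 'I_k -> 'I_m)
    (g : 'I_k -> 'I_n) (V : 'M[R]_(m, n)) :
  ~~ injectiveb g -> \det (mxsub h g V) = 0.
Proof.
move=> /injectivePn[i [j neq_ij eq_g]]; rewrite -det_tr.
by rewrite (determinant_alternate neq_ij) // => l; rewrite !mxE eq_g.
Qed.

(** * From index functions to subsets; the derivative of a split polynomial *)

Lemma sum_inj_ffun_subsets (S : comNzRingType) (V : nmodType) (k m : nat)
    (F : S -> V) (x : 'I_m -> S) :
  \sum_(h : {ffun 'I_k -> 'I_m} | injectiveb h) F (\prod_j x (h j)) =
  (\sum_(I : {set 'I_m} | #|I| == k) F (\prod_(i in I) x i)) *+ k`!.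
Proof.
rewrite (partition_big (fun h : {ffun 'I_k -> 'I_m} => h @: 'I_k)
           (fun I => #|I| == k)) /= => [|h /injectiveP h_inj]; last first.
  by rewrite card_imset // card_ord.
rewrite -sumrMnl; apply: eq_bigr => I /eqP card_I.
transitivity (\sum_(h : {ffun 'I_k -> 'I_m} | injectiveb h && (h @: 'I_k == I))
    F (\prod_(i in I) x i)).
  apply: eq_bigr => h /andP[/injectiveP h_inj /eqP <-]; congr F.
  by rewrite big_imset //= => i j _ _ /h_inj.
rewrite big_const iter_addr_0; congr (_ *+ _).
have := card_inj_ffuns_on 'I_k (mem I); rewrite card_ord card_I ffactnn => <-.
apply: eq_card => h; rewrite !inE unfold_in andbC.
case: injectiveP => h_inj; rewrite ?andbF ?andbT //=.
apply/eqP/forallP => [im_h j|h_I]; first by rewrite -im_h imset_f.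
apply/eqP; rewrite eqEcard card_imset ?card_ord ?card_I ?leqnn ?andbT //.
by apply/fintype.subsetP => _ /imsetP[j _ ->]; apply: h_I.
Qed.

Lemma deriv_prod (R : comNzRingType) (I : eqType) (r : seq I) (F : I -> {poly R}) :
  uniq r ->
  (\prod_(i <- r) F i)^`() =
  \sum_(i <- r) (F i)^`() * \prod_(j <- r | j != i) F j.
Proof.
elim: r => [|i r IHr] /=; first by rewrite !big_nil derivC.
case/andP=> i_notin_r uniq_r; rewrite !big_cons derivM IHr // eqxx.
congr (_ * _ + _).
  rewrite [RHS]big_seq_cond [LHS]big_seq; apply: eq_bigl => j.
  by have [->|] := eqVneq j i; rewrite ?andbT // (negPf i_notin_r).
rewrite big_distrr [LHS]big_seq [RHS]big_seq; apply: eq_bigr => j r_j.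
rewrite big_cons ifT; first by rewrite mulrCA.
by apply: contraNneq i_notin_r => ->.
Qed.

Lemma deriv_prod_XsubC (R : comNzRingType) (m : nat) (d : 'I_m.+1 -> R) :
  (\prod_i ('X - (d i)%:P))^`() =
  \sum_(I : {set 'I_m.+1} | #|I| == m) \prod_(i in I) ('X - (d i)%:P).
Proof.
rewrite deriv_prod ?index_enum_uniq //.
(* Omitting one factor is keeping an m-subset. The default [ord0] is never taken: the complement of
   an m-subset is a singleton. *)
rewrite (reindex_onto (fun i : 'I_m.+1 => [set~ i])
    (fun I => odflt ord0 [pick i in ~: I])) /=; last first.
  move=> I /eqP card_I.
  have /cards1P[i eq_i] : #|~: I| == 1%N.
    by rewrite cardsCs finset.setCK card_I card_ord subSnn.
  rewrite eq_i; case: pickP => [j|/(_ i)]; last by rewrite set11.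
  by rewrite inE => /eqP ->; rewrite -eq_i finset.setCK.
apply: eq_big => [i|i _]; last first.
  by rewrite derivXsubC mul1r; apply: eq_bigl => j; rewrite !inE.
rewrite cardsC1 card_ord eqxx finset.setCK /=.
by case: pickP => [j|/(_ i)]; [rewrite inE => /eqP ->; rewrite eqxx | rewrite set11].
Qed.

(** * Compression to the complement of (1,...,1) *)

(** Since [V *m U] is 1, the characteristic matrix is V (X - diag d) U. Cauchy-Binet expands its
    determinant over m-subsets, all with the same coefficient: a principal m-minor of [U *m V],
    equal to 1 - m/(m+1). *)
Lemma char_poly_compression (F : numFieldType) (m : nat)
    (V : 'M[F]_(m, m.+1)) (U : 'M[F]_(m.+1, m)) (d : 'rV[F]_m.+1) :
  V *m U = 1%:M -> U *m V = 1%:M - const_mx m.+1%:R^-1 ->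
  char_poly (V *m diag_mx d *m U) =
  m.+1%:R^-1 *: (\prod_i ('X - (d 0 i)%:P))^`().
Proof.
move=> VU UV.
pose Vp := map_mx polyC V; pose Up := map_mx polyC U.
pose dp := \row_i ('X - (d 0 i)%:P).
have -> : char_poly (V *m diag_mx d *m U) =
    \det (mxsub id id (Vp *m diag_mx dp *m Up)).
  rewrite mxsub_id; congr (\det _).
  have -> : diag_mx dp = 'X%:M - map_mx polyC (diag_mx d).
    by apply/matrixP => i j; rewrite !mxE raddfMn mulrnBl.
  rewrite mulmxBr mulmxBl scalar_mxC -(mulmxA _ Vp) -map_mxM VU map_mx1 mulmx1.
  by rewrite /char_poly_mx !map_mxM.
have fact_neq0 : m`!%:R != 0 :> F by rewrite pnatr_eq0 -lt0n fact_gt0.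
apply: (scalerI fact_neq0); rewrite !scaler_nat det_mxsub_mul_diag.
rewrite (bigID (fun g : {ffun 'I_m -> 'I_m.+1} => injectiveb g)) /= addrC.
rewrite big1 ?add0r => [|g g_ninj]; last first.
  by rewrite (@det_mxsub_not_inj _ _ _ _ id g) // !mul0r.
rewrite deriv_prod_XsubC scalerMnr.
rewrite -(@sum_inj_ffun_subsets _ _ _ _ id (fun i => 'X - (d 0 i)%:P)) scaler_sumr.
apply: eq_bigr => g /injectiveP g_inj.
have -> : \det (mxsub id g Vp) * \det (mxsub g id Up) = (m.+1%:R^-1)%:P.
  rewrite mulrC -det_mulmx.
  have -> : mxsub g id Up *m mxsub id g Vp = map_mx polyC (mxsub g g (U *m V)).
    by rewrite -!map_mxsub -map_mxM mxsub_mul.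
  rewrite det_map_mx UV det_mxsub_1_sub_const //; congr polyC.
  apply: (mulfI (x := m.+1%:R)); first by rewrite pnatr_eq0.
  by rewrite mulrBr mulr1 mulrnAr mulfV ?pnatr_eq0 // -natr1 addrAC subrr add0r.
by rewrite mul_polyC; congr (_ *: _); apply: eq_bigr => i _; rewrite mxE.
Qed.

Lemma exists_isometry_const_ortho (C : numClosedFieldType) (m : nat) :
  exists2 V : 'M[C]_(m, m.+1), V \is unitarymx &
    V^t* *m V = 1%:M - const_mx m.+1%:R^-1.
Proof.
pose u : 'rV[C]_m.+1 := const_mx 1.
have uu : u *m u^t* = m.+1%:R%:M.
  apply/matrixP => i j; rewrite !mxE !ord1 eqxx mulr1n.
  under eq_bigr => l _ do rewrite !mxE conjC1 mulr1.
  by rewrite sumr_const card_ord.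
have u_neq0 : u != 0.
  by apply/eqP => /rowP/(_ 0); rewrite !mxE; apply/eqP/oner_neq0.
pose O := orthomx Num.conj (mx_of_hermitian (hermitian1mx _)) u.
have rank_O : \rank O = m by rewrite rank_ortho rank_rV u_neq0 subSS subn0.
have [V V_unitary Vu] :
    exists2 V : 'M[C]_(m, m.+1), V \is unitarymx & V *m u^t* = 0.
  suff exV q : \rank O = q ->
      exists2 V : 'M[C]_(q, m.+1), V \is unitarymx & V *m u^t* = 0 by exact: exV.
  move=> <-; exists (schmidt (row_base O)).
    by rewrite schmidt_unitarymx // rank_leq_col.
  apply/orthomx1P.
  by rewrite eqmx_schmidt_free ?row_base_free // eq_row_base.
exists V => //.
have uV : u *m V^t* = 0.
  by rewrite -[u]trmxCK -map_mxM -trmx_mul Vu trmx0 map_mx0.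
(* Both factors are square, so they also multiply to 1 in the other order, which writes 1 as the
   projection on [u] plus [V^t* *m V]. *)
have WW : col_mx u V *m row_mx (m.+1%:R^-1 *: u^t*) (V^t*) = 1%:M :> 'M_(1 + m).
  rewrite mul_col_row -!scalemxAr uu Vu uV (unitarymxP V_unitary).
  by rewrite scale_scalar_mx mulVf ?pnatr_eq0 // scaler0 -scalar_mx_block.
have := mulmx1C WW; rewrite mul_row_col -scalemxAl => <-.
have -> : m.+1%:R^-1 *: (u^t* *m u) = const_mx m.+1%:R^-1.
  by apply/matrixP => i j; rewrite !mxE big_ord1 !mxE conjC1 !mulr1.
by rewrite [_ + V^t* *m V]addrC addrK.
Qed.

(** Replacing an isometry [V0] by [P *m V0] with [P] unitary preserves [V^t* *m V], so Schur's
    theorem may choose [P]. The diagonal of [T] lists the eigenvalues in an order that may differ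
    from that of [mu], whence [s]. *)
Lemma triangular_compression (C : numClosedFieldType) (m : nat)
    (d : 'I_m.+1 -> C) (mu : 'I_m -> C) :
  (0 < m)%N ->
  \prod_i ('X - (mu i)%:P) = m.+1%:R^-1 *: (\prod_i ('X - (d i)%:P))^`() ->
  exists V : 'M[C]_(m, m.+1),
  [/\ V \is unitarymx, V^t* *m V = 1%:M - const_mx m.+1%:R^-1 &
   exists2 T : 'M[C]_m, is_trig_mx T & exists2 s : 'S_m,
    forall i, mu i = T (s i) (s i) &
    V *m diag_mx (\row_i d i) *m V^t* = T].
Proof.
move=> m_gt0 mu_d.
have [V0 V0_unitary V0V0] := exists_isometry_const_ortho C m.
have [P P_unitary] := Schur (V0 *m diag_mx (\row_i d i) *m V0^t*) m_gt0.
rewrite /similar_to conjymx //; set T := P *m _ *m _ => trigT.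
have PP : P^t* *m P = 1%:M by apply: mulmx1C; apply/unitarymxP.
exists (P *m V0).
have trV : (P *m V0)^t* = V0^t* *m P^t* by rewrite trmx_mul map_mxM.
have V_unitary : P *m V0 \is unitarymx by exact: mul_unitarymx.
have VV : (P *m V0)^t* *m (P *m V0) = 1%:M - const_mx m.+1%:R^-1.
  by rewrite trV -mulmxA (mulmxA _ P) PP mul1mx.
have T_def : P *m V0 *m diag_mx (\row_i d i) *m (P *m V0)^t* = T.
  by rewrite trV /T !mulmxA.
split=> //; exists T => //.
have : perm_eq [tuple mu i | i < m] [tuple T i i | i < m].
  apply: prod_XsubC_eq; rewrite !big_map -enumT !big_enum /= mu_d.
  rewrite -char_poly_trig // -T_def.
  rewrite (@char_poly_compression _ _ _ _ _ (unitarymxP V_unitary) VV).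
  by congr (_ *: _^`()); apply: eq_bigr => i _; rewrite mxE.
case/tuple_permP => s eq_mu; exists s => // i.
have := congr1 (fun t : seq C => nth 0 t i) eq_mu.
by rewrite -!tnth_nth !tnth_mktuple.
Qed.

(** * Jensen's inequality and the averaging of minors *)

Lemma convex_on_complex2 (R : realType) (f : R[i] -> R) (t : R) (x y : R[i]) :
  convex_on_complex f -> 0 <= t -> t <= 1 ->
  f (t%:C * x + (1 - t)%:C * y) <= t * f x + (1 - t) * f y.
Proof.
move=> f_convex t_ge0 t_le1.
have mem_setT (z : Rcomplex R) : z \in [set: Rcomplex R]%classic by apply/mem_set.
have := f_convex (Itv01 t_ge0 t_le1) x y (mem_setT x) (mem_setT y).
rewrite /conv /=; congr (f _ <= _).
by case: x y => [a b] [c e]; simpc.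
Qed.

(** Dividing by the total weight, rather than assuming it to be 1, lets the induction pass to the
    tail. *)
Lemma convex_on_complex_Jensen (R : realType) (f : R[i] -> R) (I : eqType)
    (r : seq I) (w : I -> R) (z : I -> R[i]) :
  convex_on_complex f -> (forall i, 0 <= w i) -> 0 < \sum_(i <- r) w i ->
  f ((\sum_(i <- r) w i)^-1%:C * \sum_(i <- r) (w i)%:C * z i) <=
  (\sum_(i <- r) w i)^-1 * \sum_(i <- r) w i * f (z i).
Proof.
move=> f_convex w_ge0; elim: r => [|a r IHr]; first by rewrite big_nil ltxx.
rewrite !big_cons; set W := \sum_(j <- r) w j => W_gt0.
have W_ge0 : 0 <= W by apply: sumr_ge0.
(* A tail of total weight 0 cannot be normalized, but all its weights vanish. *)
have [W0|W_neq0] := eqVneq W 0.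
  have w0 i : i \in r -> w i = 0.
    move/eqP: W0; rewrite psumr_eq0 // => /allP w0 /w0 /eqP //.
  move: W_gt0; rewrite W0 addr0 => wa_gt0.
  rewrite [X in _ + X]big_seq big1 => [|i /w0 ->]; last by rewrite mul0r.
  rewrite [X in _ <= _ * (_ + X)]big_seq [X in _ <= _ * (_ + X)]big1 => [|i /w0 ->].
    by rewrite !addr0 !mulrA -rmorphM mulVf ?gt_eqF // !mul1r.
  by rewrite mul0r.
have Wr_gt0 : 0 < W by rewrite lt_def W_neq0.
set t := w a / (w a + W).
have t_eq : 1 - t = (w a + W)^-1 * W.
  apply: (mulIf (lt0r_neq0 W_gt0)).
  rewrite mulrBl mul1r divfK ?lt0r_neq0 // mulrAC mulVf ?lt0r_neq0 //.
  by rewrite mul1r addrAC subrr add0r.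
have -> : (w a + W)^-1%:C * ((w a)%:C * z a + \sum_(j <- r) (w j)%:C * z j) =
    t%:C * z a + (1 - t)%:C * (W^-1%:C * \sum_(j <- r) (w j)%:C * z j).
  rewrite t_eq mulrDr !mulrA -!rmorphM; congr (_%:C * _ + _%:C * _).
    by rewrite mulrC.
  by rewrite mulfK.
have t_ge0 : 0 <= t by rewrite divr_ge0 ?w_ge0 ?ltW.
have t_le1 : t <= 1 by rewrite -subr_ge0 t_eq mulr_ge0 ?invr_ge0 ?ltW.
apply: le_trans (convex_on_complex2 _ _ _ _ _ f_convex t_ge0 t_le1) _.
rewrite mulrDr mulrA [_^-1 * w a]mulrC lerD2l.
apply: le_trans (ler_wpM2l _ (IHr Wr_gt0)) _; first by rewrite subr_ge0.
by rewrite t_eq mulrA mulfK.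
Qed.

Lemma sum_convex_compression_le (R : realType) (f : R[i] -> R) (m k : nat)
    (V : 'M[R[i]]_(m, m.+1)) (d : 'rV[R[i]]_m.+1) :
  convex_on_complex f -> V \is unitarymx ->
  V^t* *m V = 1%:M - const_mx m.+1%:R^-1 ->
  is_trig_mx (V *m diag_mx d *m V^t*) ->
  \sum_(h : {ffun 'I_k -> 'I_m} | injectiveb h)
     f (\prod_j (V *m diag_mx d *m V^t*) (h j) (h j)) <=
  (1 - k%:R / m.+1%:R) *
  \sum_(g : {ffun 'I_k -> 'I_m.+1} | injectiveb g) f (\prod_j d 0 (g j)).
Proof.
move=> f_convex /unitarymxP VV V'V trigT.
have fact_neq0 (F : numFieldType) : k`!%:R != 0 :> F.
  by rewrite pnatr_eq0 -lt0n fact_gt0.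
(* The squared modulus of a k-minor of [V], divided by k! because each set of columns arises from k!
   functions. *)
pose W (h : {ffun 'I_k -> 'I_m}) (g : {ffun 'I_k -> 'I_m.+1}) : R[i] :=
  \det (mxsub h g V) * \det (mxsub g h (V^t*)) / k`!%:R.
have W_ge0 h g : 0 <= W h g.
  rewrite divr_ge0 ?ler0n //.
  have -> : mxsub g h (V^t*) = (mxsub h g V)^t*.
    by apply/matrixP => i j; rewrite !mxE.
  by rewrite det_map_mx det_tr mul_conjC_ge0.
pose w h g := complex.Re (W h g).
have w_ge0 h g : 0 <= w h g by have := W_ge0 h g; rewrite lecE => /andP[].
have wE h g : (w h g)%:C = W h g.
  have := W_ge0 h g; rewrite /w; case: (W h g) => a b.
  by rewrite lecE /= => /andP[/eqP -> _].
have sum_w_g (h : {ffun 'I_k -> 'I_m}) : injective h -> \sum_g w h g = 1.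
  move=> h_inj; apply: (@complexI R); rewrite rmorph_sum /=.
  under eq_bigr => g _ do rewrite wE.
  rewrite -big_distrl /= sum_det_mxsub VV.
  have -> : mxsub h h 1%:M = 1%:M :> 'M[R[i]]_k.
    by apply/matrixP => i j; rewrite !mxE (inj_eq h_inj).
  by rewrite det1 mulfV.
have sum_w_h (g : {ffun 'I_k -> 'I_m.+1}) : injective g ->
    \sum_h w h g = 1 - k%:R / m.+1%:R.
  move=> g_inj; apply: (@complexI R); rewrite rmorph_sum /=.
  under eq_bigr => h _ do rewrite wE /W [X in X / _]mulrC.
  rewrite -big_distrl /= sum_det_mxsub V'V det_mxsub_1_sub_const //.
  apply: (canLR (mulfK (fact_neq0 _))); rewrite mulr_natr; congr (_ *+ _).
  by rewrite rmorphB rmorph1 fmorph_div !rmorph_nat mulr_natl.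
have w_ninj_h (h : {ffun _ -> _}) g : ~~ injectiveb h -> w h g = 0.
  move=> h_ninj; rewrite /w /W (@det_mxsub_not_inj _ _ _ _ g h) //.
  by rewrite mulr0 mul0r.
have w_ninj_g h (g : {ffun _ -> _}) : ~~ injectiveb g -> w h g = 0.
  move=> g_ninj; rewrite /w /W (@det_mxsub_not_inj _ _ _ _ h g) //.
  by rewrite !mul0r.
apply: (@le_trans _ _ (\sum_(h : {ffun 'I_k -> 'I_m} | injectiveb h)
    \sum_g w h g * f (\prod_j d 0 (g j)))).
  apply: ler_sum => h /injectiveP h_inj.
  have := @convex_on_complex_Jensen R f _ (index_enum _) (w h)
    (fun g => \prod_j d 0 (g j)) f_convex (w_ge0 h).
  rewrite sum_w_g // invr1 !mul1r => /(_ ltr01); congr (f _ <= _).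
  (* The diagonal product is a principal minor of a triangular matrix; Cauchy-Binet expands it as
     the weighted mean. *)
  apply: (mulIf (fact_neq0 R[i])).
  rewrite [RHS]mulr_natr -det_mxsub_trig // det_mxsub_mul_diag big_distrl /=.
  by apply: eq_bigr => g _; rewrite wE mulrAC divfK.
(* Summing over h first, each value of [f] is multiplied by a column sum of weights; non-injective
   functions have weight 0. *)
rewrite exchange_big big_distrr /=.
rewrite (bigID (fun g : {ffun 'I_k -> 'I_m.+1} => injectiveb g)) /=.
rewrite [X in _ + X]big1 ?addr0 => [|g g_ninj]; last first.
  by rewrite big1 // => h _; rewrite w_ninj_g // mul0r.
apply: ler_sum => g /injectiveP g_inj.
rewrite -big_distrl -(sum_w_h g g_inj) /=.
rewrite [X in _ <= X * _](bigID (fun h : {ffun 'I_k -> 'I_m} => injectiveb h)) /=.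
by rewrite [X in _ <= (_ + X) * _]big1 ?addr0 => [|h /w_ninj_h ->].
Qed.

(** Absorbs the unknown order of the [mu i] on the triangular diagonal. *)
Lemma sum_inj_ffun_perm (V : nmodType) (S : comNzRingType) (m k : nat)
    (F : S -> V) (x : 'I_m -> S) (s : 'S_m) :
  \sum_(h : {ffun 'I_k -> 'I_m} | injectiveb h) F (\prod_j x (s (h j))) =
  \sum_(h : {ffun 'I_k -> 'I_m} | injectiveb h) F (\prod_j x (h j)).
Proof.
rewrite [RHS](reindex_inj (h := fun h : {ffun 'I_k -> 'I_m} => [ffun j => s (h j)])).
  apply: eq_big => [h|h _]; last by congr F; apply: eq_bigr => j _; rewrite ffunE.
  apply/injectiveP/injectiveP => h_inj i j; first by rewrite !ffunE => /perm_inj/h_inj.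
  by move=> eq_h; apply: h_inj; rewrite !ffunE eq_h.
move=> h1 h2 /ffunP eq12; apply/ffunP => j.
by have := eq12 j; rewrite !ffunE => /perm_inj.
Qed.

Theorem theorem4p6 (R : realType) (n : nat) (p : {poly R[i]})
  (lambda : 'I_n -> R[i]) (mu : 'I_n.-1 -> R[i])
  (n_ge2 : (2 <= n)%N)
  (size_p : size p = n.+1)
  (roots_p : lists_roots p lambda)
  (roots_p' : lists_roots p^`() mu)
  (f : R[i] -> R) (f_convex : convex_on_complex f)
  (alpha : R[i]) (k : nat) (k_gt0 : (1 <= k)%N) (k_le : (k <= n.-1)%N) :
  mean_subprod f alpha k mu <= mean_subprod f alpha k lambda.
Proof.
case: n => [//|m] /= in lambda mu n_ge2 size_p roots_p roots_p' k_le *.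
have lead_neq0 : lead_coef p != 0 by rewrite lead_coef_eq0 -size_poly_eq0 size_p.
have mu_lambda :
    \prod_i ('X - (mu i)%:P) = m.+1%:R^-1 *: (\prod_i ('X - (lambda i)%:P))^`().
  have eq_scaled : lead_coef p^`() *: \prod_i ('X - (mu i)%:P) =
      lead_coef p *: (\prod_i ('X - (lambda i)%:P))^`().
    by rewrite -roots_p' [in LHS]roots_p derivZ.
  have lead_p' : lead_coef p^`() = m.+1%:R * lead_coef p.
    have := congr1 (fun q : {poly R[i]} => q`_m) eq_scaled.
    have coef_prod q (x : 'I_q -> R[i]) : (\prod_i ('X - (x i)%:P))`_q = 1.
      have /monicP := monic_prod_XsubC (index_enum _) xpredT x.
      by rewrite lead_coefE size_prod_XsubC [index_enum _]unlock -enumT size_enum_ord.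
    by rewrite !coefZ coef_deriv !coef_prod mulr1 mulr_natr mulr_natl.
  apply: (scalerI (a := m.+1%:R * lead_coef p)).
    by rewrite mulf_neq0 ?pnatr_eq0.
  by rewrite -{1}lead_p' eq_scaled scalerA mulrAC mulfV ?mul1r ?pnatr_eq0.
have [V [V_unitary V'V [T trigT [s mu_T VdV]]]] :=
  @triangular_compression _ _ _ _ n_ge2 mu_lambda.
(* As [V *m V^t*] is 1, shifting the roots by [alpha] shifts the compression by [alpha]. *)
have VdaV : V *m diag_mx (\row_i (lambda i - alpha)) *m V^t* = T - alpha%:M.
  have -> : diag_mx (\row_i (lambda i - alpha)) =
      diag_mx (\row_i lambda i) - alpha%:M.
    by apply/matrixP => i j; rewrite !mxE mulrnBl.
  rewrite mulmxBr mulmxBl VdV scalar_mxC -mulmxA (unitarymxP V_unitary).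
  by rewrite mulmx1.
have trigTa : is_trig_mx (T - alpha%:M).
  apply/is_trig_mxP => i j lt_ij; rewrite !mxE (is_trig_mxP trigT) //.
  by rewrite -val_eqE ltn_eqF // mulr0n subr0.
have factk_gt0 : 0 < k`!%:R :> R by rewrite ltr0n fact_gt0.
have binR_gt0 q : (k <= q)%N -> 0 < 'C(q, k)%:R :> R by rewrite ltr0n bin_gt0.
have le_sum : \sum_(I : {set 'I_m} | #|I| == k) f (\prod_(i in I) (mu i - alpha)) <=
    (1 - k%:R / m.+1%:R) *
    \sum_(I : {set 'I_m.+1} | #|I| == k) f (\prod_(i in I) (lambda i - alpha)).
  rewrite -(ler_pM2l factk_gt0) mulrCA !mulr_natl.
  rewrite -(@sum_inj_ffun_subsets _ _ _ _ f (fun i => mu i - alpha)).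
  rewrite -(@sum_inj_ffun_subsets _ _ _ _ f (fun i => lambda i - alpha)).
  have := @sum_convex_compression_le R f m k V (\row_i (lambda i - alpha))
    f_convex V_unitary V'V.
  rewrite VdaV => /(_ trigTa).
  rewrite -(@sum_inj_ffun_perm _ _ _ _ f (fun i => (T - alpha%:M) i i) s).
  rewrite [k%:R / _]mulr_natl; congr (_ <= _ * _).
    apply: eq_bigr => h _; congr f; apply: eq_bigr => j _.
    by rewrite !mxE mu_T eqxx mulr1n.
  by apply: eq_bigr => h _; congr f; apply: eq_bigr => j _; rewrite mxE.
rewrite /mean_subprod ler_pdivrMl ?binR_gt0 // mulrA.
(* The factor 1 - k/(m+1) is exactly the ratio C(m,k)/C(m+1,k) of the two normalizations. *)
apply: le_trans le_sum _; rewrite le_eqVlt; apply/orP; left; apply/eqP; congr (_ * _).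
have m1_neq0 : m.+1%:R != 0 :> R by rewrite pnatr_eq0.
apply: (mulIf m1_neq0); rewrite mulrBl mul1r divfK // mulrAC -natrM mulnC (mul_bin_down m.+1).
have k_le_m1 := leqW k_le.
rewrite natrM mulfK; last exact: lt0r_neq0 (binR_gt0 _ k_le_m1).
by rewrite natrB.
Qed.
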